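(* For all integers $d,n,k\ge1$, the group $\mathrm{OB}(\mathbb{Z}^d,n,k)$ of oblivious Turing machines is amenable.
   Context: Let $\Sigma=\{0,\dots,n-1\}$, $Q=\{1,\dots,k\}$. Let $X_k=\{y\in\{0,1,\dots,k\}^{\mathbb{Z}^d} : y_{\vec u}\ne0\text{ and }y_{\vec v}\neq 0\implies \vec u=\vec v\}$ and $X_{n,k}=\Sigma^{\mathbb{Z}^d}\times X_k$. Given finite $F,F'\subset\mathbb{Z}^d$ and $f:\Sigma^F\times Q\to\Sigma^{F'}\times Q\times\mathbb{Z}^d$ (a local rule), the map $T_f:X_{n,k}\to X_{n,k}$ is defined by: $T_f(x,y)=(x,y)$ if $y$ is identically $0$; otherwise let $\vec v$ be the unique position with $q=y_{\vec v}\ne 0$, let $p\in\Sigma^F$ with $p_{\vec u}=x_{\vec v+\vec u}$, and $f(p,q)=(p',q',\vec e)$; then $T_f(x,y)=(\tilde x,\tilde y)$ with $\tilde x_{\vec t}=p'_{\vec t-\vec v}$ if $\vec t-\vec v\in F'$, $\tilde x_{\vec t}=x_{\vec t}$ otherwise, and $\tilde y_{\vec v+\vec e}=q'$, $\tilde y_{\vec t}=0$ for $\vec t\ne\vec v+\vec e$. Such maps are the $(d,n,k)$-Turing machines; one is reversible if it has a two-sided inverse that is a $(d,n,k)$-Turing machine. The reversible ones form the group $\mathrm{RTM}(\mathbb{Z}^d,n,k)$ under composition. $\mathrm{SHIFT}(\mathbb{Z}^d,n,k)$ is the group of machines $T_{\vec v}$ ($\vec v\in\mathbb{Z}^d$)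 which never modify the state or the tape and always move the head by $\vec v$. $\mathrm{LP}(\mathbb{Z}^d,n,k)$ (local permutations) is the subgroup of $\mathrm{RTM}(\mathbb{Z}^d,n,k)$ of machines that never move the head (the move component of the local rule is constantly $\vec 0$). $\mathrm{OB}(\mathbb{Z}^d,n,k)=\langle \mathrm{SHIFT}(\mathbb{Z}^d,n,k),\mathrm{LP}(\mathbb{Z}^d,n,k)\rangle\le \mathrm{RTM}(\mathbb{Z}^d,n,k)$. *)

(* Defs.v *)
From HB Require Import structures.
From mathcomp Require Import all_boot all_order all_algebra finmap.
From mathcomp Require Import all_classical all_reals.
Set Implicit Arguments.
Unset Strict Implicit.
Unset Printing Implicit Defensive.
Import Order.TTheory GRing.Theory Num.Theory.

Local Open Scope classical_set_scope.
Local Open Scope ring_scope.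

Notation cell d := 'rV[int]_d.
Notation tape d n := (cell d -> 'I_n).

(* The states 1, ..., k are represented by the elements of 'I_k and the
   headless symbol 0 by None, so that {0, ..., k} is option 'I_k. *)
Definition single_head (d k : nat) (y : cell d -> option 'I_k) : Prop :=
  forall u v, y u <> None -> y v <> None -> u = v.

Definition heads (d k : nat) := {y : cell d -> option 'I_k | single_head y}.

Definition config (d n k : nat) : Type := (tape d n * heads d k)%type.

Lemma single_head_at d k (v : cell d) (q : 'I_k) :
  single_head (fun t => if t == v then Some q else None).
Proof. by move=> s t /=; case: eqP => [-> _|//]; case: eqP => [->|]. Qed.

Definition head_at d k (v : cell d) (q : 'I_k) : heads d k :=
  exist _ _ (@single_head_at d k v q).

Definition local_rule (d n k : nat) (F F' : {fset cell d}) : Type :=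
  {ffun F -> 'I_n} * 'I_k -> {ffun F' -> 'I_n} * 'I_k * cell d.

Definition read d n (F : {fset cell d}) (x : tape d n) (v : cell d) :
    {ffun F -> 'I_n} :=
  [ffun u => x (v + val u)].

Definition write d n (F' : {fset cell d}) (x : tape d n) (v : cell d)
    (p' : {ffun F' -> 'I_n}) : tape d n :=
  fun t => if insub (t - v) is Some u then p' u else x t.

Definition tm_map d n k (F F' : {fset cell d}) (f : local_rule n k F F')
    (c : config d n k) : config d n k :=
  match pselect (exists vq, sval c.2 vq.1 = Some vq.2) with
  | left has_head =>
      let: (v, q) := sval (cid has_head) in
      let: (p', q', e) := f (read F c.1 v, q) in
      (write c.1 v p', head_at (v + e) q')
  | right _ => c
  end.

Definition is_TM d n k (T : config d n k -> config d n k) : Prop :=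
  exists (F F' : {fset cell d}) (f : local_rule n k F F'), T = tm_map f.

Definition is_RTM d n k (T : config d n k -> config d n k) : Prop :=
  is_TM T /\ exists T', [/\ is_TM T', cancel T T' & cancel T' T].

Record RTM (d n k : nat) := MkRTM {
  rtm_map :> config d n k -> config d n k;
  rtm_mapP : is_RTM rtm_map }.

Lemma heads_inj d k (y y' : heads d k) : sval y = sval y' -> y = y'.
Proof.
case: y y' => y hy [y' hy'] /= e; case: y' / e hy' => hy'.
by congr exist; exact: Prop_irrelevance.
Qed.

Lemma tm_map_head d n k (F F' : {fset cell d}) (f : local_rule n k F F')
    (c : config d n k) v q : sval c.2 v = Some q ->
  tm_map f c = let: (p', q', e) := f (read F c.1 v, q) in
               (write c.1 v p', head_at (v + e) q').
Proof.
rewrite /tm_map => hv; case: pselect => [h|[]]; last by exists (v, q).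
case: cid => -[w r] /= hw.
have ew : w = v by apply: (svalP c.2); rewrite ?hw ?hv.
by move: hw; rewrite ew hv => -[<-].
Qed.

Lemma tm_map_nohead d n k (F F' : {fset cell d}) (f : local_rule n k F F')
    (c : config d n k) : (forall v, sval c.2 v = None) -> tm_map f c = c.
Proof. by rewrite /tm_map => h; case: pselect => // hh; exfalso; case: hh => -[v q]; rewrite h. Qed.

Lemma head_cases d n k (c : config d n k) :
  (forall v, sval c.2 v = None) \/ exists v q, sval c.2 v = Some q.
Proof.
have [[v [q h]]|h] := pselect (exists v q, sval c.2 v = Some q).
  by right; exists v, q.
by left=> v; case e : (sval c.2 v) => [q|//]; case: h; exists v, q.
Qed.

Lemma is_TM_local d n k (T : config d n k -> config d n k)
    (W : {fset cell d}) (stp : tape d n -> 'I_k -> tape d n * 'I_k * cell d) :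
  (forall x x' q, (forall u, u \in W -> x u = x' u) ->
     [/\ (stp x q).1.2 = (stp x' q).1.2, (stp x q).2 = (stp x' q).2 &
         forall u, u \in W -> (stp x q).1.1 u = (stp x' q).1.1 u]) ->
  (forall x q t, t \notin W -> (stp x q).1.1 t = x t) ->
  (forall c : config d n k, (forall v, sval c.2 v = None) -> T c = c) ->
  (forall (c : config d n k) v q, sval c.2 v = Some q ->
     let s := stp (fun u => c.1 (v + u)) q in
     T c = (fun t => s.1.1 (t - v), head_at (v + s.2) s.1.2)) ->
  is_TM T.
Proof.
move=> hloc hout hno hhd.
pose W0 := (0 |` W)%fset.
have i0 : 0 \in W0 by rewrite !inE eqxx.
pose ext (p : {ffun W0 -> 'I_n}) : tape d n :=
  fun t => if insub t is Some u then p u else p [` i0]%fset.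
pose f : local_rule n k W0 W0 := fun pq =>
  let s := stp (ext pq.1) pq.2 in ([ffun u => s.1.1 (val u)], s.1.2, s.2).
exists W0, W0, f; apply: funext => c.
case: (head_cases c) => [h|[v [q h]]]; first by rewrite hno // tm_map_nohead.
rewrite (hhd _ _ _ h) (tm_map_head _ h) /f /=.
set x := fun u => c.1 (v + u); set x' := ext _.
have ex u : u \in W0 -> x u = x' u.
  by move=> uW; rewrite /x' /ext insubT ffunE.
have exW u : u \in W -> x u = x' u by move=> uW; apply: ex; rewrite !inE uW orbT.
have [<- <- et] := hloc x x' q exW.
congr pair; apply: funext => t; rewrite /write.
have [tW|tW] := boolP (t - v \in W0).
  rewrite insubT ffunE SubK.
  have [tW'|tW'] := boolP (t - v \in W); first exact: et.
  by rewrite !hout // ex.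
rewrite insubN // hout; first by rewrite /x addrC subrK.
by apply: contra tW => tW; rewrite !inE tW orbT.
Qed.

Lemma is_TM_id d n k : is_TM (@idfun (config d n k)).
Proof.
apply: (@is_TM_local _ _ _ _ fset0 (fun x q => (x, q, 0))) => //.
move=> c v q h; rewrite /= addr0.
case: c h => x y /= h; congr pair.
  by apply: funext => t; rewrite addrC subrK.
apply: heads_inj; apply: funext => t /=; case: eqP => [->//|ne].
case e : (sval y t) => [r|//]; case: ne.
by apply: (svalP y); rewrite ?e ?h.
Qed.

Lemma is_TM_comp d n k (T2 T1 : config d n k -> config d n k) :
  is_TM T2 -> is_TM T1 -> is_TM (T2 \o T1).
Proof.
move=> [F2 [F2' [f2 ->]]] [F1 [F1' [f1 ->]]].
pose moves := [fset (f1 pq).2 | pq : {ffun F1 -> 'I_n} * 'I_k]%fset.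
pose W : {fset cell d} := (F1 `|` F1' `|`
  [fset (e + u)%R | e in moves, u in (F2 `|` F2')%fset])%fset.
pose stp (x : tape d n) (q : 'I_k) : tape d n * 'I_k * cell d :=
  let r1 := f1 (read F1 x 0, q) in
  let x1 := write x 0 r1.1.1 in
  let r2 := f2 (read F2 x1 r1.2, r1.1.2) in
  (write x1 r1.2 r2.1.1, r2.1.2, r1.2 + r2.2).
have WF1 u : u \in F1 -> u \in W by move=> h; rewrite !inE h.
have WF1' u : u \in F1' -> u \in W by move=> h; rewrite !inE h orbT.
have WF2 pq u : u \in (F2 `|` F2')%fset -> (f1 pq).2 + u \in W.
  move=> h; rewrite inE; apply/orP; right.
  apply: in_imfset2 => //.
  by apply/imfsetP; exists pq.
apply: (@is_TM_local _ _ _ _ W stp).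
- move=> x x' q exx.
  have e1 : read F1 x 0 = read F1 x' 0.
    by apply/ffunP => u; rewrite !ffunE add0r exx // WF1 // fsvalP.
  rewrite /stp -e1; set r1 := f1 _.
  have ew u : u \in W -> write x 0 r1.1.1 u = write x' 0 r1.1.1 u.
    by rewrite /write => uW; case: insubP => // _; exact: exx.
  have e2 : read F2 (write x 0 r1.1.1) r1.2 = read F2 (write x' 0 r1.1.1) r1.2.
    by apply/ffunP => u; rewrite !ffunE ew // WF2 // !inE fsvalP.
  rewrite /= -e2; split=> // u uW; move: (ew u uW).
  set a := write x _ _; set b := write x' _ _ => eab.
  by rewrite /write; case: insubP.
- move=> x q t tW; rewrite /stp /= {1}/write insubN; last first.
    apply: contra tW => h.
    by rewrite -(subrK (f1 (read F1 x 0, q)).2 t) addrC WF2 // inE h orbT.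
  by rewrite /write insubN // subr0; apply: contra tW; exact: WF1'.
- by move=> c h; rewrite /= (tm_map_nohead f1) ?(tm_map_nohead f2).
move=> c v q h; rewrite /= (tm_map_head f1 h).
have er : read F1 (fun u => c.1 (v + u)) 0 = read F1 c.1 v.
  by apply/ffunP => u; rewrite !ffunE add0r.
rewrite /stp er; case: (f1 _) => -[p1 q1] e1 /=.
have ht : sval (head_at (v + e1) q1) (v + e1) = Some q1 by rewrite /= eqxx.
rewrite (tm_map_head f2 (c := (write c.1 v p1, head_at (v + e1) q1)) ht) /=.
have ewr t : write (fun u => c.1 (v + u)) 0 p1 t = write c.1 v p1 (v + t).
  by rewrite /write subr0 [v + t]addrC addrK.
have -> : read F2 (write (fun u => c.1 (v + u)) 0 p1) e1 =
    read F2 (write c.1 v p1) (v + e1).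
  by apply/ffunP => u; rewrite !ffunE ewr addrA.
case: (f2 _) => -[p2 q2] e2 /=; rewrite addrA; congr pair.
apply: funext => t; rewrite {1 3}/write opprD addrA.
by case: insubP => // _; rewrite ewr addrC subrK.
Qed.

Lemma is_RTM_id d n k : is_RTM (@idfun (config d n k)).
Proof. by split; [exact: is_TM_id|exists idfun; split=> //; exact: is_TM_id]. Qed.

Lemma is_RTM_comp d n k (T2 T1 : RTM d n k) : is_RTM (T2 \o T1).
Proof.
case: T2 T1 => [T2 [h2 [S2 [k2 c2 c2']]]] [T1 [h1 [S1 [k1 c1 c1']]]] /=.
split; first exact: is_TM_comp.
by exists (S1 \o S2); split; [exact: is_TM_comp|exact: can_comp|exact: can_comp].
Qed.

Definition rtm_inv_map d n k (T : RTM d n k) : config d n k -> config d n k :=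
  sval (cid (rtm_mapP T).2).

Lemma rtm_inv_mapP d n k (T : RTM d n k) :
  [/\ is_TM (rtm_inv_map T), cancel T (rtm_inv_map T) & cancel (rtm_inv_map T) T].
Proof. exact: (svalP (cid (rtm_mapP T).2)). Qed.

Lemma is_RTM_inv d n k (T : RTM d n k) : is_RTM (rtm_inv_map T).
Proof.
have [h c c'] := rtm_inv_mapP T; split=> //; exists T; split=> //.
by case: (rtm_mapP T).
Qed.

Lemma rtm_inj d n k (S T : RTM d n k) : rtm_map S = rtm_map T -> S = T.
Proof.
case: S T => S hS [T hT] /= e; case: T / e hT => hT.
by congr MkRTM; exact: Prop_irrelevance.
Qed.

HB.instance Definition _ d n k := gen_eqMixin (RTM d n k).
HB.instance Definition _ d n k := gen_choiceMixin (RTM d n k).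

Section RTMGroup.
Variables d n k : nat.
Implicit Types S T U : RTM d n k.

Definition rtm_one : RTM d n k := MkRTM (@is_RTM_id d n k).
Definition rtm_mul S T : RTM d n k := MkRTM (is_RTM_comp S T).
Definition rtm_inv T : RTM d n k := MkRTM (is_RTM_inv T).

Lemma rtm_mulA : associative rtm_mul.
Proof. by move=> S T U; exact: rtm_inj. Qed.

Lemma rtm_mul1T : left_id rtm_one rtm_mul.
Proof. by move=> T; exact: rtm_inj. Qed.

Lemma rtm_mulT1 : right_id rtm_one rtm_mul.
Proof. by move=> T; exact: rtm_inj. Qed.

Lemma rtm_mulVT : left_inverse rtm_one rtm_inv rtm_mul.
Proof.
move=> T; apply: rtm_inj; apply: funext => c /=.
by have [_ ->] := rtm_inv_mapP T.
Qed.

Lemma rtm_mulTV : right_inverse rtm_one rtm_inv rtm_mul.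
Proof.
move=> T; apply: rtm_inj; apply: funext => c /=.
by have [_ _ ->] := rtm_inv_mapP T.
Qed.

HB.instance Definition _ :=
  isGroup.Build (RTM d n k) rtm_mulA rtm_mul1T rtm_mulT1 rtm_mulVT rtm_mulTV.

End RTMGroup.

Definition shift_rule d n k (v : cell d) : local_rule n k fset0 fset0 :=
  fun pq => (pq.1, pq.2, v).

Definition SHIFT d n k : set (RTM d n k) :=
  [set T | exists v : cell d, rtm_map T = tm_map (shift_rule v)].

(* When n > 0, T determines the displacement of the head on every
   configuration, so the choice of the local rule f is immaterial. *)
Definition LP d n k : set (RTM d n k) :=
  [set T | exists (F F' : {fset cell d}) (f : local_rule n k F F'),
     (forall pq, (f pq).2 = 0) /\ rtm_map T = tm_map f].

Definition subgroup (G : groupType) (H : set G) : Prop :=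
  [/\ H 1%g, forall g h, H g -> H h -> H (g * h)%g & forall g, H g -> H g^-1%g].

Definition generated (G : groupType) (S : set G) : set G := smallest (@subgroup G) S.

Lemma generated_subgroup (G : groupType) (S : set G) : subgroup (generated S).
Proof.
split=> [H HS|g h hg hh H HS|g hg H HS]; case: (HS) => -[h1 hM hV] _ //.
  by apply: hM; [exact: hg|exact: hh].
by apply: hV; exact: hg.
Qed.

Definition OBset d n k : set (RTM d n k) :=
  generated (@SHIFT d n k `|` @LP d n k).

Definition OBpred d n k : {pred RTM d n k} := fun T => `[< OBset T >].

Lemma OB_closed d n k : group_closed (@OBpred d n k).
Proof.
have [h1 hM hV] := generated_subgroup (@SHIFT d n k `|` @LP d n k).
split; first exact/asboolP.
by move=> S T /asboolP hS /asboolP hT; apply/asboolP; exact: hM hS (hV _ hT).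
Qed.

Record OB (d n k : nat) := MkOB {
  ob_val :> RTM d n k;
  ob_valP : ob_val \in @OBpred d n k }.

HB.instance Definition _ d n k := [isSub of OB d n k for @ob_val d n k].
HB.instance Definition _ d n k := [Choice of OB d n k by <:].
HB.instance Definition _ d n k :=
  SubChoice_isSubGroup.Build (RTM d n k) (@OBpred d n k) (OB d n k)
    (@OB_closed d n k).

(* A discrete group is amenable when it carries a finitely additive,
   left-invariant probability measure defined on all of its subsets. *)
Definition amenable (R : realType) (G : groupType) : Prop :=
  exists mu : set G -> R,
    [/\ forall A, 0 <= mu A,
        mu setT = 1,
        forall A B, A `&` B = set0 -> mu (A `|` B) = mu A + mu B &
        forall g A, mu [set (g * a)%g | a in A] = mu A].

(* Main.v *)
(* Shifts normalise LP, and the permutations of the pattern in a finite window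
   (together with the state) form finite groups whose union over all windows
   is LP, so OB is locally-finite-by-Z^d.  For the Folner sequence of OB, take
   the products T_v * P with v in the box [0, N]^d and P a permutation of a
   window W_N.  A machine L of LP satisfies L * T_v = T_v * (T_v^-1 * L * T_v),
   where the conjugate acts on the window W_N for all v in the box once W_N is
   large, so L permutes the N-th Folner set; a unit shift permutes it up to
   one face of the box, a fraction 1/(N + 1).  The invariant mean is the limit
   of the frequencies along an ultrafilter. *)
Require Import Defs.
From mathcomp Require Import all_boot all_order all_algebra perm finmap.
From mathcomp Require Import all_classical all_reals.
From mathcomp Require Import topology normedtype.
Set Implicit Arguments.
Unset Strict Implicit.
Unset Printing Implicit Defensive.
Import Order.TTheory GRing.Theory Num.Theory.
Import numFieldNormedType.Exports.

Local Open Scope classical_set_scope.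
Local Open Scope ring_scope.

(** * Invariant means as ultralimits of frequencies *)

(** Compactness gives a cluster point, and an ultrafilter converges to its cluster points: if it
    missed a neighbourhood it would contain the complement, which would then have to meet that
    neighbourhood. *)
Lemma ultra_cvg_segment (R : realType) (U : set_system nat) (a : nat -> R)
    (x y : R) :
  UltraFilter U -> (forall N, x <= a N <= y) ->
  exists2 l, x <= l <= y & a @ U --> l.
Proof.
move=> UU axy; have UP : ProperFilter U := @ultra_proper _ _ UU.
have [|l [+ al]] := @segment_compact _ x y (a @ U) _.
  by apply: (@filterE _ U) => N; rewrite /= in_itv; exact: axy.
rewrite /= in_itv /= => lxy; exists l => // V Vl.
have [//|UV] := in_ultra_setVsetC (a @^-1` V) UU.
by have [z []] := al (~` V) V UV Vl.
Qed.

Lemma leq_card_subU (I : finType) (A B C : pred I) :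
  (forall i, A i -> B i || C i) -> (#|A| <= #|B| + #|C|)%N.
Proof.
move=> sABC; rewrite -cardUI; apply: leq_trans (leq_addr _ _).
by apply/subset_leq_card/fintype.subsetP => i; rewrite !inE; exact: sABC.
Qed.

(** The Folner sets are indexed families, counted with multiplicity. Almost invariance under [g] is
    expressed by a bijection [s] of the indices that follows translation by [g] outside a fraction
    at most [1/m]. Generators suffice, since the elements preserving [mu] form a subgroup. *)
Lemma amenable_folner (R : realType) (G : groupType) (I : nat -> finType)
    (E : forall N, I N -> G) (S : set G) :
  (forall N, 0 < #|I N|)%N -> generated S = setT ->
  (forall g m, S g -> exists N0, forall N, (N0 <= N)%N ->
    exists2 s : I N -> I N, injective s &
      (#|[pred i | E N (s i) != (g * E N i)%g]| * m <= #|I N|)%N) ->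
  amenable R G.
Proof.
move=> I_gt0 genS folS.
have I_gt0R N : 0 < #|I N|%:R :> R by rewrite ltr0n.
pose hit (A : set G) N : pred (I N) := [pred i | `[< A (E N i) >]].
pose a A N : R := #|hit A N|%:R / #|I N|%:R.
have a01 A N : 0 <= a A N <= 1.
  by rewrite divr_ge0 //= ler_pdivrMr // mul1r ler_nat max_card.
have [U [UU sU]] := ultraFilterLemma eventually_filter.
have UP : ProperFilter U := @ultra_proper _ _ UU.
have cv A : exists l : R, 0 <= l <= 1 /\ a A @ U --> l.
  by have [l] := ultra_cvg_segment UU (a01 A); exists l.
pose mu A : R := sval (cid (cv A)).
have mu_ge0 A : 0 <= mu A by case: (svalP (cid (cv A))) => /andP[].
have muP A : a A @ U --> mu A by case: (svalP (cid (cv A))).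
have muE A (l : R) : a A @ U --> l -> mu A = l
    by move=> al; apply: (cvg_unique _ (muP A) al).
have mu_shift g A : S g -> mu [set (g * x)%g | x in A] = mu A.
  move=> Sg; set B := [set _ | _ in _].
  have BE x : B (g * x)%g = A x.
    by rewrite propeqE; split=> [[y Ay /mulgI <-]|Ax] //; exists x.
  apply: muE; rewrite -[mu A]addr0.
  have -> : a B = a A \+ (a B \- a A).
    by apply/funext => N /=; rewrite addrC subrK.
  (* The difference of frequencies tends to 0 along [\oo], hence along [U], which refines it. *)
  apply: cvgD => //; apply: cvg_trans (_ : (a B \- a A) @ \oo --> 0).
    by move=> V; exact: sU.
  apply/cvgrPdist_le => e e0.
  pose m := (Num.truncn e^-1).+1.
  have me : m%:R^-1 <= e.
    by rewrite -[leRHS]invrK lef_pV2 ?posrE ?invr_gt0 // ltW // truncnS_gt.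
  have [N0 hN0] := folS g m Sg.
  exists N0 => // N /= /hN0[s s_inj].
  set bad := [pred i | _] => badm.
  (* Reindexing the hits of [B] along [s] compares them index by index with the hits of [A]; the two
     can differ only on [bad]. *)
  have cardB : #|[pred i | hit B N (s i)]| = #|hit B N|.
    by rewrite -!sum1_card [RHS](reindex_inj s_inj).
  have hitE i : ~~ bad i -> hit B N (s i) = hit A N i.
    by move=> /negPn/eqP eqs; rewrite /hit /= eqs BE.
  have leBA : (#|hit B N| <= #|hit A N| + #|bad|)%N.
    rewrite -cardB; apply: leq_card_subU => i Bi; apply/orP.
    by have [|/hitE <-] := boolP (bad i); [right|left].
  have leAB : (#|hit A N| <= #|hit B N| + #|bad|)%N.
    rewrite -cardB; apply: leq_card_subU => i Ai; apply/orP.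
    have [|/hitE eqi] := boolP (bad i); first by right.
    by left; rewrite -eqi in Ai.
  rewrite sub0r normrN /= -mulrBl normrM (gtr0_norm (x := _^-1)) ?invr_gt0 //.
  rewrite ler_pdivrMr //.
  have badR : #|bad|%:R <= e * #|I N|%:R.
    apply: le_trans (_ : m%:R^-1 * #|I N|%:R <= _); last by rewrite ler_pM2r.
    by rewrite ler_pdivlMl ?ltr0n // -natrM ler_nat mulnC.
  by apply: le_trans badR; rewrite ler_distl lerBlDr -!natrD !ler_nat leAB leBA.
exists mu; split=> //.
- apply: muE; rewrite (_ : a setT = fun=> 1); first exact: cvg_cst.
  apply/funext => N; rewrite /a (_ : #|_| = #|I N|) ?divff ?gt_eqF //.
  by apply: eq_card => i; rewrite !inE; apply/asboolP.
- move=> A B AB0; apply: muE.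
  rewrite (_ : a (A `|` B) = a A \+ a B); first exact: cvgD.
  apply/funext => N /=; rewrite /a -mulrDl -natrD -cardUI.
  rewrite [X in (_ + X)%N]eq_card0 ?addn0 => [|i]; last first.
    rewrite !inE; apply/negP => /andP[/asboolP Ai /asboolP Bi].
    by suff: set0 (E N i) by []; rewrite -AB0.
  congr (_%:R / _); apply: eq_card => i; rewrite !inE.
  by apply/asboolP/orP => -[] h; [left|right|left|right]; apply/asboolP.
- suff sG : subgroup [set g | forall A, mu [set (g * x)%g | x in A] = mu A].
    move=> g; have : generated S g by rewrite genS.
    by move=> /(_ _ (conj sG _)); apply => h Sh A; exact: mu_shift.
  have imM (g h : G) A : [set (g * h * x)%g | x in A] =
      [set (g * x)%g | x in [set (h * x)%g | x in A]].
    by rewrite image_comp; apply: eq_imagel => x _; rewrite /= mulgA.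
  have im1 (A : set G) : [set (1 * x)%g | x in A] = A.
    by rewrite -[RHS]image_id; apply: eq_imagel => x _; rewrite mul1g.
  split=> [A|g h hg hh A|g hg A]; first by rewrite im1.
    by rewrite imM hg hh.
  by rewrite -hg -imM mulgV im1.
Qed.

(** * Calculus of shifts and stationary machines *)

Section TuringMachines.
Variables d n k : nat.
Implicit Types (x : tape d n) (u v : cell d) (q : 'I_k) (W F : {fset cell d}).

Lemma config_cases (P : config d n k -> Prop) :
  (forall c, (forall v, sval c.2 v = None) -> P c) ->
  (forall x v q, P (x, head_at v q)) -> forall c, P c.
Proof.
move=> P0 P1 c; have [/P0//|[v [q vq]]] := head_cases c.
suff -> : c = (c.1, head_at v q) by exact: P1.
case: c vq => x y /= vq; congr pair; apply: heads_inj; apply: funext => t /=.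
case: eqP => [->//|tv]; case e : (sval y t) => [r|//]; case: tv.
by apply: (svalP y); rewrite ?e ?vq.
Qed.

Lemma tm_map_at F F' (f : local_rule n k F F') x v q :
  tm_map f (x, head_at v q) =
  let r := f (read F x v, q) in (write x v r.1.1, head_at (v + r.2) r.1.2).
Proof.
rewrite (@tm_map_head _ _ _ _ _ _ (x, head_at v q) v q) /= ?eqxx //.
by case: (f _) => -[].
Qed.

Lemma read_write W x v (p : {ffun W -> 'I_n}) : read W (write x v p) v = p.
Proof. by apply/ffunP => u; rewrite ffunE /write addrC addKr valK. Qed.

Lemma write_write W x v (p p' : {ffun W -> 'I_n}) :
  write (write x v p) v p' = write x v p'.
Proof. by apply: funext => t; rewrite /write; case: insubP. Qed.

Lemma write_read W x v : write x v (read W x v) = x.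
Proof.
apply: funext => t; rewrite /write; case: insubP => // u _ uE.
by rewrite ffunE uE addrC subrK.
Qed.

Lemma shift_at u x v q :
  tm_map (@shift_rule d n k u) (x, head_at v q) = (x, head_at (v + u) q).
Proof.
rewrite tm_map_at /=; congr pair; apply: funext => t.
by rewrite /write insubN.
Qed.

Lemma shift_comp u v :
  tm_map (@shift_rule d n k u) \o tm_map (shift_rule v) =
  tm_map (shift_rule (u + v)).
Proof.
apply: funext; apply: config_cases => [c c0|x w q] /=.
  by rewrite (tm_map_nohead (shift_rule v)) // !tm_map_nohead.
by rewrite !shift_at -addrA [v + u]addrC.
Qed.

Lemma shift0 : tm_map (@shift_rule d n k 0) = idfun.
Proof.
apply: funext; apply: config_cases => [c c0|x w q] /=.
  by rewrite tm_map_nohead.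
by rewrite shift_at addr0.
Qed.

Lemma shift_is_RTM v : is_RTM (tm_map (@shift_rule d n k v)).
Proof.
split; first by exists fset0, fset0, (shift_rule v).
exists (tm_map (shift_rule (- v))); split.
- by exists fset0, fset0, (shift_rule (- v)).
- by move=> c; have := congr1 (@^~ c) (shift_comp (- v) v); rewrite addNr shift0.
- by move=> c; have := congr1 (@^~ c) (shift_comp v (- v)); rewrite addrN shift0.
Qed.

(** The same window is read and written, so composing machines amounts to composing the maps [g]. *)
Definition stay_rule W
    (g : {ffun W -> 'I_n} * 'I_k -> {ffun W -> 'I_n} * 'I_k) :
  local_rule n k W W := fun pq => (g pq, 0).

Lemma stay_at W g x v q : tm_map (@stay_rule W g) (x, head_at v q) =
  (write x v (g (read W x v, q)).1, head_at v (g (read W x v, q)).2).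
Proof. by rewrite tm_map_at /= addr0. Qed.

Lemma stay_comp W g h :
  tm_map (@stay_rule W g) \o tm_map (stay_rule h) = tm_map (stay_rule (g \o h)).
Proof.
apply: funext; apply: config_cases => [c c0|x w q] /=.
  by rewrite (tm_map_nohead (stay_rule h)) // !tm_map_nohead.
by rewrite !stay_at read_write write_write -surjective_pairing.
Qed.

Lemma stay_id W : tm_map (@stay_rule W id) = idfun.
Proof.
apply: funext; apply: config_cases => [c c0|x w q] /=.
  by rewrite tm_map_nohead.
by rewrite stay_at write_read.
Qed.

Lemma stay_is_RTM W (s : {perm {ffun W -> 'I_n} * 'I_k}) :
  is_RTM (tm_map (stay_rule s)).
Proof.
split; first by exists W, W, (stay_rule s).
exists (tm_map (stay_rule s^-1%g)); split.
- by exists W, W, (stay_rule s^-1%g).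
- move=> c; have sK : s^-1%g \o s = id by apply: funext => p /=; rewrite permK.
  by have := congr1 (@^~ c) (stay_comp s^-1%g s); rewrite sK stay_id.
- move=> c; have sK : s \o s^-1%g = id by apply: funext => p /=; rewrite permKV.
  by have := congr1 (@^~ c) (stay_comp s s^-1%g); rewrite sK stay_id.
Qed.

(** Patterns extend to tapes by padding with the symbol 0, available because [n] is positive; pairs
    merged by [g] would then give configurations merged by the machine. *)
Lemma stay_inj W g : (0 < n)%N ->
  injective (tm_map (@stay_rule W g)) -> injective g.
Proof.
move=> n_gt0 g_inj [p q] [p' q'] gE.
pose x r : tape d n := @write d n W (fun=> Ordinal n_gt0) 0 r.
have /g_inj[/(congr1 (fun y => read W y 0))] :
    tm_map (stay_rule g) (x p, head_at 0 q) =
    tm_map (stay_rule g) (x p', head_at 0 q').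
  by rewrite !stay_at !read_write !write_write gE.
by rewrite !read_write => -> /(congr1 (fun f => f 0)); rewrite eqxx => -[->].
Qed.

(** The conjugate applies [f] at offset [v] from the head, so it touches only the cells [v + F] and
    [v + F'], which lie in [W]; as [f] never moves the head, the two shifts cancel. *)
Lemma shift_conj F F' (f : local_rule n k F F') W v :
  (0 < n)%N -> (forall pq, (f pq).2 = 0) ->
  (forall u, u \in (F `|` F')%fset -> v + u \in W) ->
  exists g, tm_map (shift_rule (- v)) \o tm_map f \o tm_map (shift_rule v) =
            tm_map (@stay_rule W g).
Proof.
move=> n_gt0 f0 FW.
(* [g] simulates the conjugate on a padded tape with the head at the origin, then reads the window
   back. *)
pose x p : tape d n := @write d n W (fun=> Ordinal n_gt0) 0 p.
pose r pq := f (read F (x pq.1) v, pq.2).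
exists (fun pq => (read W (write (x pq.1) v (r pq).1.1) 0, (r pq).1.2)).
apply: funext; apply: config_cases => [c c0|y w q] /=.
  rewrite (tm_map_nohead (shift_rule v)) // (tm_map_nohead f) //.
  by rewrite !tm_map_nohead.
rewrite stay_at shift_at tm_map_at /= shift_at f0 addr0 addrK.
have xE u : u \in W -> x (read W y w) u = y (w + u).
  by move=> uW; rewrite /x /write subr0 insubT ffunE.
have -> : read F y (w + v) = read F (x (read W y w)) v.
  apply/ffunP => u; rewrite !ffunE xE ?addrA // FW // inE.
  by rewrite (fsvalP u).
congr pair; apply: funext => t.
rewrite {1 2}/write; have [tW|tW] := boolP (t - w \in W).
  rewrite [insub (t - w)]insubT ffunE SubK add0r /write opprD addrA.
  by case: insubP => // _; rewrite xE // addrC subrK.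
rewrite [insub (t - w)]insubN // insubN //; apply: contra tW => tF.
have -> : t - w = v + (t - (w + v)) by rewrite [RHS]addrC opprD addrA subrK.
by rewrite FW // inE tF orbT.
Qed.

(** * Shifts and window permutations as elements of OB *)

Definition shift_rtm v : RTM d n k := MkRTM (shift_is_RTM v).

Definition stay_rtm W (s : {perm {ffun W -> 'I_n} * 'I_k}) : RTM d n k :=
  MkRTM (stay_is_RTM s).

Lemma shift_OB v : shift_rtm v \in @OBpred d n k.
Proof. by apply/asboolP => H [_ SH]; apply: SH; left; exists v. Qed.

Lemma stay_OB W s : @stay_rtm W s \in @OBpred d n k.
Proof.
by apply/asboolP => H [_ SH]; apply: SH; right; exists W, W, (stay_rule s).
Qed.

Definition shift_ob v : OB d n k := MkOB (shift_OB v).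

Definition stay_ob W s : OB d n k := MkOB (@stay_OB W s).

Lemma ob_inj (S T : OB d n k) : rtm_map S = rtm_map T -> S = T.
Proof. by move=> /rtm_inj ?; exact: val_inj. Qed.

Lemma shift_obD u v : shift_ob (u + v) = (shift_ob u * shift_ob v)%g.
Proof. by apply: ob_inj; rewrite -[RHS]/(_ \o _) shift_comp. Qed.

Lemma shift_ob0 : shift_ob 0 = 1%g.
Proof. by apply: ob_inj; exact: shift0. Qed.

Lemma shift_obN v : shift_ob (- v) = (shift_ob v)^-1%g.
Proof.
by apply: (@mulgI _ (shift_ob v)); rewrite mulgV -shift_obD addrN shift_ob0.
Qed.

(* Permutations compose from left to right, machines from right to left. *)
Lemma stay_obM W (s t : {perm {ffun W -> 'I_n} * 'I_k}) :
  stay_ob (s * t)%g = (stay_ob t * stay_ob s)%g.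
Proof.
apply: ob_inj; rewrite -[RHS]/(_ \o _) stay_comp /=.
congr (tm_map (stay_rule _)).
by apply: funext => p; rewrite permM.
Qed.

(** The conjugate of [T] is a bijection of configurations, so its window map is injective, hence a
    permutation of a finite set. *)
Lemma LP_conj F F' (f : local_rule n k F F') W v (T : OB d n k) :
  (0 < n)%N -> (forall pq, (f pq).2 = 0) -> rtm_map T = tm_map f ->
  (forall u, u \in (F `|` F')%fset -> v + u \in W) ->
  exists s, (T * shift_ob v)%g = (shift_ob v * @stay_ob W s)%g.
Proof.
move=> n_gt0 f0 Tf FW; have [g gE] := shift_conj n_gt0 f0 FW.
have TE : rtm_map ((shift_ob v)^-1 * T * shift_ob v)%g = tm_map (stay_rule g).
  by rewrite -gE -Tf -shift_obN.
have g_inj : injective g.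
  apply: (stay_inj n_gt0); rewrite -TE.
  by have [_ [h [_ /can_inj]]] := rtm_mapP ((shift_ob v)^-1 * T * shift_ob v)%g.
exists (perm g_inj); rewrite -(mulVKg (shift_ob v) (T * _)%g); congr (_ * _)%g.
apply: ob_inj; rewrite mulgA TE; congr (tm_map (stay_rule _)).
by apply: funext => p; rewrite permE.
Qed.

(** Unit shifts yield all shifts, since every cell is an integer combination of the vectors
    [delta_mx 0 i]. *)
Lemma OB_generated : generated
  ([set shift_ob (delta_mx 0 i) | i in [set: 'I_d]] `|`
   [set T : OB d n k | LP (ob_val T)]) = setT.
Proof.
rewrite -subTset => T _ H [[H1 HM HV] SH].
have Hshift v : H (shift_ob v).
  have HN w : H (shift_ob w) -> H (shift_ob (- w)).
    by move=> Hw; rewrite shift_obN; exact: HV.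
  rewrite [v]row_sum_delta; elim/big_ind: _ => [|u w hu hw|i _].
  - by rewrite shift_ob0.
  - by rewrite shift_obD; exact: HM.
  have Hn m : H (shift_ob (delta_mx 0 i *+ m)).
    elim: m => [|m IHm]; first by rewrite mulr0n shift_ob0.
    by rewrite mulrS shift_obD; apply: HM => //; apply: SH; left; exists i.
  by case: (v 0 i) => m; rewrite ?NegzE ?scaleNr -natz scaler_nat; [|apply: HN].
(* Generation is known inside [RTM], so [H] is replaced by its image there, a subgroup containing
   SHIFT and LP. *)
suff : [set S | exists2 T' : OB d n k, ob_val T' = S & H T'] (ob_val T).
  by move=> [T' /val_inj <-].
have /asboolP := ob_valP T; apply; split.
  split=> [|_ _ [S <- hS] [S' <- hS']|_ [S <- hS]].
  - by exists 1%g.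
  - by exists (S * S')%g => //; exact: HM.
  - by exists S^-1%g => //; exact: HV.
move=> S [[v Sv]|SLP].
  by exists (shift_ob v) => //; apply: rtm_inj; rewrite Sv.
have SOB : S \in @OBpred d n k by apply/asboolP => K [_ SK]; apply: SK; right.
by exists (MkOB SOB) => //; apply: SH; right.
Qed.
End TuringMachines.

(** * The Folner sequence and its almost invariance *)

Definition corner_pos d N (f : {ffun 'I_d -> 'I_N.+1}) : cell d :=
  \row_i (f i)%:Z.

(* The second summand ranges over the cells of code less than N, so that
   every finite set of cells is eventually covered by these summands. *)
Definition window d N : {fset cell d} :=
  [fset u in [seq (corner_pos f + v)%R | f <- enum {: {ffun 'I_d -> 'I_N.+1}},
                                          v <- pmap choice.unpickle (iota 0 N)]]%fset.

Lemma mem_window d N (f : {ffun 'I_d -> 'I_N.+1}) (u : cell d) :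
  (choice.pickle u < N)%N -> corner_pos f + u \in window d N.
Proof.
move=> uN; rewrite inE /=; apply: allpairs_f; first by rewrite mem_enum.
by rewrite mem_pmap -[Some u]choice.pickleK map_f // mem_iota.
Qed.

Definition folner_index d n k N : finType :=
  ({ffun 'I_d -> 'I_N.+1} * {perm {ffun window d N -> 'I_n} * 'I_k})%type.

Definition folner_seq d n k N (i : folner_index d n k N) : OB d n k :=
  (shift_ob n k (corner_pos i.1) * stay_ob i.2)%g.

(** Making the unit step cyclic turns it into a permutation of the box; it differs from the
    translation only on the last face. *)
Definition rotate_coord d N (j : 'I_d) (f : {ffun 'I_d -> 'I_N.+1}) :
    {ffun 'I_d -> 'I_N.+1} := [ffun l => if l == j then ordS (f l) else f l].

Lemma rotate_coord_inj d N (j : 'I_d) : injective (@rotate_coord d N j).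
Proof.
move=> f g /ffunP fg; apply/ffunP => l; move: (fg l); rewrite !ffunE.
by case: eqP => // _ /ordS_inj.
Qed.

Lemma corner_pos_rotate d N (j : 'I_d) (f : {ffun 'I_d -> 'I_N.+1}) :
  f j != ord_max -> corner_pos (rotate_coord j f) = delta_mx 0 j + corner_pos f.
Proof.
move=> fj; apply/rowP => l; rewrite !mxE ffunE eqxx /=.
have [->|_] := eqVneq l j; last by rewrite add0r.
rewrite /= modn_small ?intS // ltnS ltn_neqAle -ltnS ltn_ord andbT.
by apply: contra fj => /eqP e; apply/eqP/val_inj.
Qed.

(** Bad indices have [j]-th coordinate [ord_max], which leaves them at most a fraction [1/(N + 1)]
    of all indices. *)
Lemma folner_shift d n k (j : 'I_d) m N : (m <= N)%N ->
  exists2 s : folner_index d n k N -> folner_index d n k N, injective s &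
    (#|[pred i | folner_seq (s i) !=
         (shift_ob n k (delta_mx 0 j)%R * folner_seq i)%g]| * m
      <= #|folner_index d n k N|)%N.
Proof.
move=> mN; exists (fun i => (rotate_coord j i.1, i.2)).
  by move=> [f p] [g q] [/rotate_coord_inj -> ->].
set bad := [pred i | _].
have badj i : i \in bad -> i.1 j = ord_max.
  apply: contraNeq => /corner_pos_rotate iE.
  by rewrite /folner_seq /= iE shift_obD mulgA.
apply: leq_trans (_ : #|bad| * N.+1 <= _)%N.
  by rewrite leq_mul2l ltnW ?orbT.
(* Overwriting the [j]-th coordinate by an arbitrary value loses nothing on [bad], where the old
   value is known, so [N.+1] disjoint copies of [bad] fit in the index set. *)
pose upd (x : folner_index d n k N * 'I_N.+1) : folner_index d n k N :=
  ([ffun l => if l == j then x.2 else x.1.1 l], x.1.2).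
suff upd_inj : {in [predX bad & 'I_N.+1] &, injective upd}.
  rewrite -[X in (_ * X)%N](card_ord N.+1) -cardX.
  by rewrite -(card_in_image upd_inj) max_card.
move=> [[f p] a] [[g q] b] /andP[/badj /= fj _] /andP[/badj /= gj _].
move=> [/ffunP fg ->]; congr (_, _, _); last first.
  by move: (fg j); rewrite !ffunE eqxx.
apply/ffunP => l; have [->|lj] := eqVneq l j; first by rewrite fj gj.
by move: (fg l); rewrite !ffunE (negbTE lj).
Qed.

(** For large [N] no index is bad: moving [T] past the shift to a corner [p] leaves a window
    permutation that depends on [p] alone. *)
Lemma folner_LP d n k (T : OB d n k) m : (0 < n)%N -> LP (ob_val T) ->
  exists N0, forall N, (N0 <= N)%N ->
  exists2 s : folner_index d n k N -> folner_index d n k N, injective s &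
    (#|[pred i | folner_seq (s i) != (T * folner_seq i)%g]| * m
      <= #|folner_index d n k N|)%N.
Proof.
move=> n_gt0 [F [F' [f [f0 Tf]]]].
(* Beyond this bound, every cell of [F] and [F'] has code less than [N], so all its translates by
   corners lie in the window. *)
exists (\max_(u <- (F `|` F')%fset) choice.pickle u).+1%N => N hN.
have sE (p : {ffun 'I_d -> 'I_N.+1}) : exists s,
    (T * shift_ob n k (corner_pos p))%g =
    (shift_ob n k (corner_pos p) * @stay_ob d n k (window d N) s)%g.
  apply: (LP_conj n_gt0 f0 Tf) => u uF; apply: mem_window.
  by apply: leq_trans hN; rewrite ltnS; exact: leq_bigmax_seq.
have [s {}sE] := choice sE.
(* The factor [s i.1] goes on the right because [stay_ob] reverses products; the corner is kept, so
   cancelling this factor gives injectivity. *)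
exists (fun i => (i.1, i.2 * s i.1)%g) => [[p a] [q b] /= [<- /mulIg ->]//|].
rewrite eq_card0 // => i; rewrite !inE; apply/negbF/eqP.
by rewrite /folner_seq /= stay_obM !mulgA sE.
Qed.

Theorem proposition3 (R : realType) (d n k : nat)
    (hd : (1 <= d)%N) (hn : (1 <= n)%N) (hk : (1 <= k)%N) :
  amenable R (OB d n k).
Proof.
apply: (@amenable_folner R _ (folner_index d n k) (@folner_seq d n k) _ _
  (OB_generated d n k)).
  by move=> N; apply/card_gt0P; exists ([ffun=> ord0], 1%g).
move=> g m [[j _ <-]|TLP]; last exact: folner_LP.
by exists m => N; exact: folner_shift.
Qed.
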